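(* Let $n\geq 3$. Let $\nu$ be a partition of $n-2$ in which neither $1$ nor $2$ appears as a part, and let $\lambda=1^2\nu$ and $\mu=2^1\nu$ be the partitions of $n$ obtained by adjoining to $\nu$ two parts equal to $1$, respectively one part equal to $2$. Then the conjugacy classes of $S_n$ of cycle types $\lambda$ and $\mu$ belong to the same $z$-class in $S_n$. Conversely, if two distinct conjugacy classes of $S_n$ belong to the same $z$-class in $S_n$, then there is a partition $\nu$ of $n-2$ in which neither $1$ nor $2$ appears as a part such that the cycle types of the two classes are $1^2\nu$ and $2^1\nu$ (in some order).
   Context: For a group $G$, two elements $x,y\in G$ are $z$-conjugate if their centralizers $\mathcal{Z}_G(x)$ and $\mathcal{Z}_G(y)$ are conjugate subgroups of $G$; this is an equivalence relation whose classes are called $z$-classes. Conjugate elements are $z$-conjugate, so each $z$-class is a union of conjugacy classes. Conjugacy classes of the symmetric group $S_n$ correspond to partitions of $n$ via cycle type (fixed points count as parts equal to $1$). A partition of $n$ is written $\lambda_1^{e_1}\cdots\lambda_r^{e_r}$ with $1\le\lambda_1<\cdots<\lambda_r\le n$, $e_i>0$ and $\sum_i e_i\lambda_i=n$; that is, the part $\lambda_i$ occurs $e_i$ times. *)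

(* Defs.v *)
From mathcomp Require Import all_boot all_fingroup.

Set Implicit Arguments.
Unset Strict Implicit.
Unset Printing Implicit Defensive.

Import GroupScope.

Section ZClasses.

Variables (gT : finGroupType) (G : {group gT}).

Definition z_conjugate : rel gT := [rel x y | 'C_G[y] \in 'C_G[x] :^: G].

Lemma z_conjugateP x y :
  reflect (exists2 g, g \in G & 'C_G[y] = 'C_G[x] :^ g) (z_conjugate x y).
Proof. exact: imsetP. Qed.

Lemma z_conjugate_equiv : {in G & &, equivalence_rel z_conjugate}.
Proof.
move=> x y z _ _ _; split; first by apply/z_conjugateP; exists 1; rewrite ?conjsg1.
case/z_conjugateP=> g Gg def_y.
apply/z_conjugateP/z_conjugateP=> -[h Gh ->].
  by exists (g^-1 * h); rewrite ?groupM ?groupV // def_y conjsgM conjsgK.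
by exists (g * h); rewrite ?groupM // def_y conjsgM.
Qed.

Definition z_classes : {set {set gT}} :=
  equivalence_partition z_conjugate G.

Definition same_z_class (C D : {set gT}) : Prop :=
  exists2 Z, Z \in z_classes & (C \subset Z) /\ (D \subset Z).

End ZClasses.

(* A partition of m is the weakly increasing sequence of its (positive) parts,
   so that equality of partitions is equality of sequences. *)
Definition is_intpart (m : nat) (la : seq nat) : bool :=
  [&& sorted leq la, 0 \notin la & sumn la == m].

(* Orbits include those of size 1: fixed points count as parts equal to 1. *)
Definition cycle_type (n : nat) (s : 'S_n) : seq nat :=
  sort leq [seq #|X| | X : {set 'I_n} in porbits s].

Definition has_cycle_type (n : nat) (C : {set 'S_n}) (la : seq nat) : Prop :=
  forall s : 'S_n, s \in C -> cycle_type s = la.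

(* 1^2 nu and 2^1 nu; consing yields a sorted sequence as soon as the parts of
   nu are at least 2. *)
Definition adjoin_1_1 (nu : seq nat) : seq nat := [:: 1, 1 & nu]%N.
Definition adjoin_2 (nu : seq nat) : seq nat := (2 :: nu)%N.

(* Main.v *)
Require Import Defs.
From mathcomp Require Import all_boot all_fingroup.

Set Implicit Arguments.
Unset Strict Implicit.
Unset Printing Implicit Defensive.

(** Up to conjugating one of the two permutations, being z-conjugate means
    having the same centralizer, so everything rests on what 'C[s] = 'C[t] says
    about the cycles of s and t.

    A cycle of s of length at least 2, extended by the identity, commutes with s.
    If t commutes with all these cycles, then it maps each of their supports to
    itself, so every t-orbit through a point moved by s lies in its s-orbit
    [porbit_sub_cent1]. Hence s and t have the same orbit at every point that
    both of them move. Suppose s fixes a point a that t moves. All transpositions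
    of fixed points of s commute with s, hence with t; this forces the fixed
    points of s to be exactly a and t a, and {a, t a} to be a 2-cycle of t
    [fixpoints_moved_fixpoint]. It is the only 2-cycle of t, since exchanging it
    with another one commutes with t but not with s [unique_2cycle].

    So s and t have the same cycles, except that the two fixed points of s may be
    a 2-cycle of t, and the two fixed points of t may be a 2-cycle of s. If both
    or neither happen, the cycle types agree and the classes coincide; if exactly
    one happens, the cycle types are 1^2 nu and 2^1 nu, and nu has no part 1 or 2
    because the exceptional cycles are the only ones of their length
    [cycle_types_cent1_eq]. In the other direction, if s has exactly two fixed
    points a, b and no 2-cycle, then multiplying s by the transposition (a b)
    does not change the centralizer, as both centralizers preserve {a, b}
    [cent1_eq_adjoin_2].

    Cycle types are handled through the number of points lying on cycles of each
    length, which determines the type; that equal types imply conjugacy is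
    [conj_of_cycle_type]. *)

(** * z-classes of conjugacy classes *)

Lemma same_z_classP (gT : finGroupType) (G : {group gT}) (x y : gT) :
  x \in G -> y \in G ->
  same_z_class G (x ^: G)%g (y ^: G)%g <-> z_conjugate G x y.
Proof.
move=> Gx Gy; have eqvZ := @z_conjugate_equiv gT G.
have partZ := equivalence_partitionP eqvZ.
have trivZ : trivIset (z_classes G) by case/and3P: partZ.
have zJ z g : g \in G -> z_conjugate G z (z ^ g)%g.
  by move=> Gg; apply/z_conjugateP; exists g; rewrite // cent1J conjIg conjGid.
have inZ z : z \in G -> pblock (z_classes G) z \in z_classes G.
  by move=> Gz; apply: pblock_mem; rewrite (cover_partition partZ).
split=> [[Z zZ [/subsetP sxZ /subsetP syZ]] | xy].
  rewrite -(pblock_equivalence_partition eqvZ Gx Gy).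
  by rewrite (def_pblock trivZ zZ (sxZ x (class_refl G x))) syZ ?class_refl.
exists (pblock (z_classes G) x); first exact: inZ.
split; apply/subsetP=> _ /imsetP[g Gg ->];
  rewrite (pblock_equivalence_partition eqvZ) ?groupJ ?zJ //.
by rewrite ((eqvZ x y (y ^ g)%g Gx Gy (groupJ Gy Gg)).2 xy) zJ.
Qed.

(** * Orbits of permutations with the same centralizer *)

Section Orbits.

Variable T : finType.
Implicit Types (s t g : {perm T}) (x y z a b : T).

(** Counting points rather than cycles avoids any reference to the set of orbits;
    the number of k-cycles is recovered by dividing by k. *)
Definition orbit_profile s k := #|[set x | #|porbit s x| == k]|.

Lemma porbit1 s x : porbit s (s x) = porbit s x.
Proof. by have := porbit_perm s 1 x; rewrite expg1. Qed.

Lemma porbit_expg_eq s x i j :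
  ((s ^+ i)%g x == (s ^+ j)%g x) = (i == j %[mod #|porbit s x|]).
Proof.
have m_gt0 : 0 < #|porbit s x| by rewrite lt0n card_porbit_neq0.
have mod_exp k : (s ^+ k)%g x = (s ^+ (k %% #|porbit s x|))%g x.
  rewrite {1}(divn_eq k #|porbit s x|) expgD mulnC expgM permM; congr (_ _).
  have fix_m : (s ^+ #|porbit s x|)%g x = x by rewrite permX iter_porbit.
  by elim: (k %/ _) => [|q IHq]; rewrite ?perm1 // expgS permM fix_m.
rewrite (mod_exp i) (mod_exp j) !permX.
rewrite -!(nth_traject _ (ltn_pmod _ m_gt0)).
by rewrite nth_uniq ?size_traject ?ltn_pmod ?uniq_traject_porbit.
Qed.

Lemma card_porbit_dvd s x i : ((s ^+ i)%g x == x) = (#|porbit s x| %| i).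
Proof. by have := porbit_expg_eq s x i 0; rewrite perm1 mod0n. Qed.

Lemma card_porbit_eq1 s x : (#|porbit s x| == 1) = (s x == x).
Proof. by rewrite -dvdn1 -card_porbit_dvd expg1. Qed.

Lemma card_porbit_eq2 s x : (#|porbit s x| == 2) = (s x != x) && (s (s x) == x).
Proof.
rewrite -card_porbit_eq1 -permM -[(s * s)%g]/(s ^+ 2)%g card_porbit_dvd.
have [->|ne1] := eqVneq #|porbit s x| 1 => //=.
exact: (sameP eqP (prime_nt_dvdP _ ne1)).
Qed.

Lemma cent1_permP s g :
  reflect (forall x, g (s x) = s (g x)) (g \in 'C[s])%g.
Proof.
apply: (iffP cent1P) => [gs x | gs]; first by rewrite -!permM gs.
by apply/permP=> x; rewrite !permM gs.
Qed.

Lemma cent1_tperm g a b :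
  (g \in 'C[tperm a b])%g = (tperm (g a) (g b) == tperm a b).
Proof.
by rewrite cent1E [in RHS]eq_sym -tpermJ (conjgC (tperm a b))
           (inj_eq (mulgI g)).
Qed.

Lemma tperm_cent1 s a b : s a = a -> s b = b -> (tperm a b \in 'C[s])%g.
Proof. by move=> sa sb; rewrite cent1C cent1_tperm sa sb. Qed.

(** The restriction u of s to the s-orbit of z commutes with s, hence with t. If
    t z were off that orbit, u would fix t z, hence z, although s moves z. *)
Lemma porbit_sub_cent1 s t x :
  ('C[s] \subset 'C[t])%g -> s x != x -> porbit t x \subset porbit s x.
Proof.
move=> /subsetP cst sx.
have step z : z \in porbit s x -> t z \in porbit s x.
  rewrite -eq_porbit_mem => /eqP zx.
  have sz : s z != z by rewrite -card_porbit_eq1 zx card_porbit_eq1.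
  have /cst/cent1_permP/(_ z) : restr_perm (porbit s z) s \in 'C[s]%g.
    exact/cent1P/restr_perm_commute.
  have nSs : s \in 'N(porbit s z | 'P)%g.
    by apply/astabsP=> y; rewrite /= apermE -!eq_porbit_mem porbit1.
  rewrite -zx (restr_permE nSs (porbit_id s z)).
  move=> tsz; apply: contraR sz => tz.
  rewrite (out_perm (restr_perm_on _ _) tz) in tsz.
  exact/eqP/esym/(perm_inj tsz).
apply/subsetP=> _ /porbitP[i ->]; elim: i => [|i IHi].
  by rewrite perm1 porbit_id.
by rewrite expgSr permM step.
Qed.

(** If y is another fixed point of s, then t commutes with the transposition
    (a y), so that t y is the image of t a under it; unless y = t a, this is
    t a itself, contradicting the injectivity of t. *)
Lemma fixpoints_moved_fixpoint s t a :
    ('C[s] \subset 'C[t])%g -> s a = a -> t a != a ->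
  forall y, (s y == y) = (y \in [set a; t a]).
Proof.
move=> /subsetP cst sa ta.
have sta : s (t a) = t a.
  by have /cent1_permP-> := cst _ (cent1id s); rewrite sa.
move=> y; rewrite !inE; apply/eqP/orP=> [sy | [] /eqP-> //].
have [ya|ya] := eqVneq y a; [by left | right].
have /cst/cent1_permP/(_ a) := tperm_cent1 sa sy.
rewrite tpermL; case: tpermP => [/eqP|->|_ _ /perm_inj/esym/eqP].
- by rewrite (negPf ta).
- by rewrite eqxx.
- by rewrite (negPf ya).
Qed.

Lemma moved_fixpoint_involutive s t a :
  ('C[s] \subset 'C[t])%g -> s a = a -> t a != a -> t (t a) = a.
Proof.
move=> cst sa ta; have fixs := fixpoints_moved_fixpoint cst sa ta.
have sta : s (t a) = t a by apply/eqP; rewrite fixs !inE eqxx orbT.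
have /(subsetP cst)/cent1_permP/(_ a) := tperm_cent1 sa sta.
by rewrite tpermL tpermR.
Qed.

(** Exchanging {a, t a} with another 2-cycle {z, t z} of t commutes with t, hence
    with s; but it sends the fixed point a of s to z, which s moves. *)
Lemma unique_2cycle s t a :
    ('C[s] = 'C[t])%g -> s a = a -> t a != a ->
  forall z, (#|porbit t z| == 2) = (z \in [set a; t a]).
Proof.
move=> cst sa ta z; have cst1 : ('C[s] \subset 'C[t])%g by rewrite cst.
have tta := moved_fixpoint_involutive cst1 sa ta.
rewrite card_porbit_eq2; apply/andP/idP; last first.
  by rewrite !inE => /orP[]/eqP->; rewrite tta ?[a == _]eq_sym ta eqxx.
case=> tz /eqP ttz; apply/idPn=> z_out.
have:= z_out; rewrite -(fixpoints_moved_fixpoint cst1 sa ta) => /eqP[].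
move: z_out; rewrite !inE negb_or => /andP[za zta].
have atz : a != t z by apply: contra zta => /eqP->; rewrite ttz.
pose h := (tperm a z * tperm (t a) (t z))%g.
have /cent1_permP/(_ a) : (h \in 'C[s])%g.
  rewrite cst cent1C; apply/cent1P; rewrite /commute [RHS]conjgC; congr (_ * _)%g.
  rewrite conjMg !tpermJ tta ttz [RHS]conjgC tpermJ.
  by rewrite !tpermD // 1?eq_sym // (inj_eq perm_inj) eq_sym.
by rewrite sa permM tpermL tpermD // 1?eq_sym.
Qed.

Lemma profile_moved_fixpoint s t a :
  ('C[s] = 'C[t])%g -> s a = a -> t a != a ->
  orbit_profile s 1 = 2 /\ orbit_profile t 2 = 2.
Proof.
move=> cst sa ta; have cst1 : ('C[s] \subset 'C[t])%g by rewrite cst.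
have card2 : #|[set a; t a]| = 2 by rewrite cards2 eq_sym ta.
by split; apply: etrans card2; apply: eq_card => x; rewrite inE ?card_porbit_eq1;
  rewrite ?(fixpoints_moved_fixpoint cst1 sa ta) ?(unique_2cycle cst sa ta).
Qed.

Lemma porbit_eq_cent1 s t x :
  ('C[s] = 'C[t])%g -> s x != x -> t x != x -> porbit s x = porbit t x.
Proof.
by move=> cst sx tx; apply/eqP; rewrite eqEsubset !porbit_sub_cent1 ?cst.
Qed.

(** The orbits of s and t at a point differ only if one of them is a fixed point
    and the other a 2-cycle, and this does not affect lengths above 2. *)
Lemma profile_ge3 s t k :
  ('C[s] = 'C[t])%g -> 2 < k -> orbit_profile s k = orbit_profile t k.
Proof.
move=> cst k_gt2; apply: eq_card => x; rewrite !inE.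
wlog sx : s t cst / s x == x => [IH | ].
  have [sx|sx] := boolP (s x == x); first exact: IH.
  have [tx|tx] := boolP (t x == x); first by rewrite (IH t s).
  by rewrite (porbit_eq_cent1 cst).
have ltk m : m < 3 -> (m == k) = false.
  by move=> m_lt3; apply/ltn_eqF/(leq_trans m_lt3).
have:= sx; rewrite -card_porbit_eq1 => /eqP->; rewrite ltk //.
have [tx|tx] := boolP (t x == x).
  by move: tx; rewrite -card_porbit_eq1 => /eqP->; rewrite ltk.
have := unique_2cycle cst (eqP sx) tx x.
by rewrite !inE eqxx => /eqP->; rewrite ltk.
Qed.

End Orbits.

(** * Cycle types and conjugacy in the symmetric group *)

Section CycleType.

Variable n : nat.
Implicit Types (s t : 'S_n) (la : seq nat).

(** A cycle of length m contributes f m once for each of its m points. The cases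
    f = 1 and f = (- == k) give the sum of the parts and their multiplicities. *)
Lemma sum_cycle_type s (f : nat -> nat) :
  \sum_(m <- cycle_type s) f m * m = \sum_(x : 'I_n) f #|porbit s x|.
Proof.
rewrite (perm_big _ (permEl (perm_sort _ _))) big_map big_enum /=.
rewrite (partition_big_imset (porbit s)) /=.
apply: eq_bigr => _ /imsetP[x _ ->].
rewrite (eq_bigr (fun=> f #|porbit s x|)) => [|y /eqP-> //].
rewrite sum_nat_const mulnC; congr (_ * _).
by apply: eq_card => y; rewrite -eq_porbit_mem unfold_in.
Qed.

Lemma sumn_cycle_type s : sumn (cycle_type s) = n.
Proof.
have := sum_cycle_type s (fun=> 1); rewrite sumnE sum1_card card_ord => {2}<-.
by apply: eq_bigr => m _; rewrite mul1n.
Qed.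

Lemma cycle_type_gt0 s : 0 \notin cycle_type s.
Proof.
rewrite mem_sort; apply/mapP=> -[X]; rewrite mem_enum => /imsetP[x _ ->] /eqP.
by rewrite eq_sym (negPf (card_porbit_neq0 s x)).
Qed.

Lemma cycle_type_sorted s : sorted leq (cycle_type s).
Proof. exact: (sort_sorted leq_total). Qed.

Lemma count_cycle_type s k :
  count_mem k (cycle_type s) * k = orbit_profile s k.
Proof.
have -> : orbit_profile s k = \sum_(x : 'I_n) (#|porbit s x| == k).
  rewrite /orbit_profile -sum1_card big_mkcond.
  by apply: eq_bigr => x _; rewrite inE; case: (_ == k).
rewrite -(sum_cycle_type s (fun m => m == k : nat)).
rewrite -sum1_count big_distrl big_mkcond /=; apply: eq_bigr => m _.
by case: eqP => [->|_].
Qed.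

Lemma cycle_type_unique s la :
    sorted leq la -> 0 \notin la ->
    (forall k, 0 < k -> count_mem k la * k = orbit_profile s k) ->
  cycle_type s = la.
Proof.
move=> la_sorted la0 la_s.
apply: (sorted_eq leq_trans anti_leq (cycle_type_sorted s) la_sorted).
apply/allP=> k _; have [->|k_gt0] := posnP k.
  by rewrite /= !(count_memPn _) ?cycle_type_gt0.
by rewrite /= -(eqn_pmul2r k_gt0) la_s // count_cycle_type.
Qed.

Lemma eq_cycle_typeP s t :
  cycle_type s = cycle_type t <->
  (forall k, 0 < k -> orbit_profile s k = orbit_profile t k).
Proof.
split=> [st k _|st]; first by rewrite -!count_cycle_type st.
apply: cycle_type_unique (cycle_type_sorted t) (cycle_type_gt0 t) _ => k k_gt0.
by rewrite count_cycle_type st.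
Qed.

Lemma cycle_typeJ s g : cycle_type (s ^ g)%g = cycle_type s.
Proof.
apply/eq_cycle_typeP => k _.
have orbJ x : porbit (s ^ g)%g (g x) = g @: porbit s x.
  have expJ i : ((s ^ g) ^+ i)%g (g x) = g ((s ^+ i)%g x).
    by rewrite -conjXg permJ.
  apply/setP=> y; apply/porbitP/imsetP=> [[i ->]|[_ /porbitP[i ->] ->]].
    by exists ((s ^+ i)%g x); rewrite ?mem_porbit.
  by exists i.
rewrite -[RHS](card_imset _ (@perm_inj _ g)); apply: eq_card => y.
rewrite -[y](permKV g) (mem_imset _ _ (@perm_inj _ g)) !inE orbJ.
by rewrite (card_imset _ (@perm_inj _ g)).
Qed.

(* Listing the orbits by increasing length makes the list of lengths literally
   equal to the cycle type, so that two permutations with the same type have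
   their orbits matched by position. *)
Let sorted_porbits s :=
  sort (relpre (fun X : {set 'I_n} => #|X|) leq) (enum (porbits s)).

Lemma porbit_bijection s t :
  cycle_type s = cycle_type t ->
  exists f : {set 'I_n} -> {set 'I_n},
    {in porbits s, forall X, f X \in porbits t /\ #|f X| = #|X|} /\
    {in porbits s &, injective f}.
Proof.
rewrite /cycle_type /image_mem !sort_map.
rewrite -/(sorted_porbits s) -/(sorted_porbits t).
move=> eq_st; have := congr1 size eq_st; rewrite !size_map => eq_sz.
have mem_s X : (X \in sorted_porbits s) = (X \in porbits s).
  by rewrite mem_sort mem_enum.
have mem_t X : (X \in sorted_porbits t) = (X \in porbits t).
  by rewrite mem_sort mem_enum.
exists (fun X => nth set0 (sorted_porbits t) (index X (sorted_porbits s))).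
split=> [X | X Y]; rewrite -!mem_s => Xs.
  have lt_t : index X (sorted_porbits s) < size (sorted_porbits t).
    by rewrite -eq_sz index_mem.
  rewrite -mem_t mem_nth //; split=> //.
  rewrite -(nth_map _ 0 (fun X => #|pred_of_set X|)) // -eq_st.
  by rewrite (nth_map set0) ?index_mem // nth_index.
move=> Ys /eqP; rewrite nth_uniq -?eq_sz ?index_mem ?sort_uniq ?enum_uniq //.
by move/eqP/(congr1 (nth set0 (sorted_porbits s))); rewrite !nth_index.
Qed.

(** Choose a base point in each orbit of s and in the matching orbit of t; the
    conjugating permutation sends s^i (base of s) to t^i (base of t). This is
    well defined and injective because matching orbits have the same length. *)
Lemma conj_of_cycle_type s t :
  cycle_type s = cycle_type t -> exists g, t = (s ^ g)%g.
Proof.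
case/porbit_bijection=> f [f_porbit f_inj].
have porbitsP (u : 'S_n) x : porbit u x \in porbits u by exact: imset_f.
(* The default x is only there to have a value on the empty set: the chosen
   point depends on X alone when X is inhabited, see [base_eq]. *)
pose base (X : {set 'I_n}) x := odflt x [pick y in X].
have base_in (X : {set 'I_n}) x y : y \in X -> base X x \in X.
  by rewrite /base; case: pickP => [z //|/(_ y)->].
have base_eq (X : {set 'I_n}) x x' y : y \in X -> base X x = base X x'.
  by rewrite /base; case: pickP => [z //|/(_ y)->].
pose y x := base (porbit s x) x; pose z x := base (f (porbit s x)) x.
have ys x : porbit s (y x) = porbit s x.
  by apply/eqP; rewrite eq_porbit_mem; apply: base_in _ _ _ (porbit_id s x).
have zt x : porbit t (z x) = f (porbit s x).
  have [/imsetP[w _ fw] _] := f_porbit _ (porbitsP s x).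
  rewrite fw; apply/eqP; rewrite eq_porbit_mem /z fw.
  exact: base_in _ _ _ (porbit_id t w).
have card_st x : #|porbit t (z x)| = #|porbit s (y x)|.
  by rewrite zt ys; have [_ ->] := f_porbit _ (porbitsP s x).
have step x : y (s x) = y x /\ z (s x) = z x.
  rewrite /y /z porbit1; split; first exact: base_eq _ _ _ _ (porbit_id s x).
  by apply: (base_eq _ _ _ (z x)); rewrite -zt porbit_id.
have /fin_all_exists[i iP] x : exists i, (s ^+ i)%g (y x) = x.
  have /porbitP[j xE] : x \in porbit s (y x) by rewrite ys porbit_id.
  by exists j.
pose g x := (t ^+ i x)%g (z x).
have g_orbit x : porbit t (g x) = f (porbit s x) by rewrite porbit_perm zt.
have g_inj : injective g.
  move=> x x' gxx'.
  have sxx' : porbit s x = porbit s x'.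
    by apply: f_inj => //; rewrite -!g_orbit gxx'.
  have zE : z x = z x'.
    by rewrite /z sxx'; apply: (base_eq _ _ _ (z x')); rewrite -zt porbit_id.
  have yE : y x = y x' by rewrite /y sxx'; apply: base_eq _ _ _ _ (porbit_id s x').
  move/eqP: gxx'; rewrite /g -zE porbit_expg_eq card_st -porbit_expg_eq => /eqP.
  by rewrite {2}yE !iP.
have gJ x : g (s x) = t (g x).
  have [yE zE] := step x; rewrite /g zE -permM -expgSr; apply/eqP.
  by rewrite porbit_expg_eq card_st -porbit_expg_eq expgSr permM iP -yE iP.
exists (perm g_inj); apply: (mulgI (perm g_inj)); rewrite -conjgC.
by apply/permP=> x; rewrite !permM !permE gJ.
Qed.

(** * Permutations of the symmetric group with the same centralizer *)

(** The last hypothesis excludes that the two exceptional situations, a fixed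
    point of s moved by t and a fixed point of t moved by s, occur together.
    Then t has no fixed point and s has no 2-cycle, so that both types are
    determined by their common parts larger than 2, which make up nu. *)
Lemma cycle_types_moved_fixpoint s t a :
    ('C[s] = 'C[t])%g -> s a = a -> t a != a ->
    (forall x, t x = x -> s x = x) ->
  exists nu : seq nat,
    [/\ is_intpart (n - 2) nu, 1 \notin nu, 2 \notin nu,
        cycle_type s = adjoin_1_1 nu & cycle_type t = adjoin_2 nu].
Proof.
move=> cst sa ta fix_ts; have cst1 : ('C[s] \subset 'C[t])%g by rewrite cst.
have [s1 t2] := profile_moved_fixpoint cst sa ta.
have fix_s := fixpoints_moved_fixpoint cst1 sa ta.
have tta := moved_fixpoint_involutive cst1 sa ta.
have t_move x : t x != x.
  apply/eqP=> tx; have := fix_ts x tx => /eqP; rewrite fix_s !inE.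
  by case/orP=> /eqP xE; case/eqP: ta; rewrite -?[RHS]tta -xE tx.
have t1 : orbit_profile t 1 = 0.
  apply/eqP; rewrite cards_eq0; apply/eqP/setP=> x.
  by rewrite !inE card_porbit_eq1 (negPf (t_move x)).
have s2 : orbit_profile s 2 = 0.
  apply/eqP; rewrite cards_eq0; apply/eqP/setP=> x; rewrite !inE.
  apply/negP=> sx2; have := sx2; rewrite card_porbit_eq2 => /andP[sx _].
  move: sx2; rewrite (porbit_eq_cent1 cst) //.
  by rewrite (unique_2cycle cst sa ta) -fix_s (negPf sx).
pose nu := [seq k <- cycle_type s | 2 < k].
have nu_gt2 : all (ltn 2) nu by apply: filter_all.
have nu_le2 k : k <= 2 -> k \notin nu.
  by move=> k_le2; apply/negP=> /(allP nu_gt2) /=; rewrite ltnNge k_le2.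
have nu_count0 k : k <= 2 -> count_mem k nu = 0.
  by move=> k_le2; rewrite (count_memPn (nu_le2 k k_le2)).
have nu_sorted : sorted leq nu.
  exact: sorted_filter leq_trans _ _ (cycle_type_sorted s).
have nu_ge m : m <= 3 -> all (leq m) nu.
  by move=> m_le3; apply: sub_all nu_gt2 => k; apply: leq_trans.
have nu_count k : 2 < k -> count_mem k nu * k = orbit_profile s k.
  move=> k_gt2; rewrite -count_cycle_type count_filter; congr (_ * _).
  by apply: eq_count => j /=; case: eqP => [->|].
have s_type : cycle_type s = adjoin_1_1 nu.
  apply: cycle_type_unique; rewrite /adjoin_1_1 /=.
  - by rewrite path_sortedE ?nu_sorted ?nu_ge //; exact: leq_trans.
  - by rewrite !inE nu_le2.
  - case=> [|[|[|k]]] // _; first by rewrite nu_count0 ?s1.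
      by rewrite nu_count0 ?s2.
    by rewrite -nu_count.
have t_type : cycle_type t = adjoin_2 nu.
  apply: cycle_type_unique; rewrite /adjoin_2 /=.
  - by rewrite path_sortedE ?nu_sorted ?nu_ge //; exact: leq_trans.
  - by rewrite !inE nu_le2.
  - case=> [|[|[|k]]] // _; first by rewrite nu_count0 ?t1.
      by rewrite nu_count0 ?t2.
    by rewrite -(profile_ge3 cst) // -nu_count.
exists nu; split; rewrite ?nu_le2 //; apply/and3P; split; rewrite ?nu_le2 //.
have nE : 2 + sumn nu = n by rewrite -[RHS](sumn_cycle_type s) s_type.
by apply/eqP; rewrite -[in RHS]nE addKn.
Qed.


(** The permutation t is s times the transposition (a b) of the two fixed points
    of s. Since s has no 2-cycle, {a, b} is both the set of fixed points of s and
    the set of points of period dividing 2 under t. Either centralizer therefore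
    preserves {a, b}, commutes with (a b), and so is contained in the other. *)
Lemma cent1_eq_adjoin_2 s nu :
    1 \notin nu -> 2 \notin nu -> cycle_type s = adjoin_1_1 nu ->
  exists t, 'C[s]%g = 'C[t]%g /\ cycle_type t = adjoin_2 nu.
Proof.
move=> nu1 nu2 s_type.
have /cards2P[a [b [ab fixE]]] : orbit_profile s 1 == 2.
  by rewrite -count_cycle_type s_type /= (count_memPn nu1).
have fix_s x : (s x == x) = (x \in [set a; b]).
  by rewrite -fixE inE card_porbit_eq1.
have no2 x : #|porbit s x| != 2.
  have s2 : orbit_profile s 2 = 0.
    by rewrite -count_cycle_type s_type /= (count_memPn nu2).
  by move/eqP: s2; rewrite cards_eq0 => /eqP/setP/(_ x); rewrite !inE => ->.
have [sa sb] : s a = a /\ s b = b.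
  by split; apply/eqP; rewrite fix_s !inE eqxx ?orbT.
pose t := (s * tperm a b)%g.
have [ta tb] : t a = b /\ t b = a by rewrite !permM sa sb tpermL tpermR.
have t_out x : x \notin [set a; b] -> t x = s x.
  rewrite -fix_s => sx; rewrite permM tpermD //.
    by apply: contra sx => /eqP ax; rewrite -(inj_eq (@perm_inj _ s)) -ax sa.
  by apply: contra sx => /eqP bx; rewrite -(inj_eq (@perm_inj _ s)) -bx sb.
have t_invol x : t (t x) = x -> x \in [set a; b].
  move=> ttx; apply/idPn=> x_out; have sx := x_out; rewrite -fix_s in sx.
  have sx_out : s x \notin [set a; b] by rewrite -fix_s (inj_eq perm_inj).
  have := no2 x; rewrite card_porbit_eq2 sx.
  by rewrite -(t_out x x_out) -{1}(t_out (t x)) ?ttx ?eqxx // (t_out x).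
have cst : 'C[s]%g = 'C[t]%g.
  have tperm_fix (g : 'S_n) :
      g a \in [set a; b] -> g b \in [set a; b] -> g \in 'C[tperm a b]%g.
    move: ab; rewrite cent1_tperm -(inj_eq (@perm_inj _ g)) !inE.
    by move=> + /orP[]/eqP ga /orP[]/eqP gb;
      rewrite ga gb ?eqxx // tpermC eqxx.
  have cs g : g \in 'C[s]%g -> g \in 'C[tperm a b]%g.
    move/cent1_permP=> gs; apply: tperm_fix.
      by rewrite -fix_s -gs sa.
    by rewrite -fix_s -gs sb.
  have ct g : g \in 'C[t]%g -> g \in 'C[tperm a b]%g.
    move/cent1_permP=> gt.
    by apply: tperm_fix; apply: t_invol; rewrite -!gt !(ta, tb).
  apply/setP=> g; apply/idP/idP=> cg.
    by have /cent1P sab := cs g cg; apply/cent1P/commuteM => //; apply/cent1P.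
  have -> : s = (t * (tperm a b)^-1)%g by rewrite mulgK.
  apply/cent1P/commuteM; first exact/cent1P.
  by apply/commuteV/cent1P/ct.
exists t; split=> //.
have [|x tx|mu [_ _ _ mu_s mu_t]] := @cycle_types_moved_fixpoint s t a cst sa.
- by rewrite ta eq_sym.
- rewrite -t_out ?tx //; move: ab; apply: contra; rewrite !inE.
  by case/orP=> /eqP xE; move/eqP: tx; rewrite xE ?ta ?tb // eq_sym.
by move: mu_s mu_t; rewrite s_type => -[<-].
Qed.

Lemma cycle_types_cent1_eq s t :
    'C[s]%g = 'C[t]%g -> cycle_type s <> cycle_type t ->
  exists nu : seq nat,
    [/\ is_intpart (n - 2) nu, 1 \notin nu, 2 \notin nu &
        cycle_type s = adjoin_1_1 nu /\ cycle_type t = adjoin_2 nu \/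
        cycle_type s = adjoin_2 nu /\ cycle_type t = adjoin_1_1 nu].
Proof.
move=> cst neq_st.
have [/existsP[a /andP[/eqP sa ta]] | /existsPn fix_s] :=
    boolP [exists a, (s a == a) && (t a != a)];
  have [/existsP[c /andP[/eqP tc sc]] | /existsPn fix_t] :=
    boolP [exists c, (t c == c) && (s c != c)].
- case: neq_st; apply/eq_cycle_typeP.
  have [s1 t2] := profile_moved_fixpoint cst sa ta.
  have [t1 s2] := profile_moved_fixpoint (esym cst) tc sc.
  move=> [|[|[|k]]] // _; rewrite ?s1 ?s2 //.
  exact: profile_ge3.
- have [x tx|nu [? ? ? ? ?]] := cycle_types_moved_fixpoint cst sa ta.
    by apply/eqP; have := fix_t x; rewrite tx eqxx negbK.
  by exists nu; split=> //; left.
- have [x sx|nu [? ? ? ? ?]] := cycle_types_moved_fixpoint (esym cst) tc sc.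
    by apply/eqP; have := fix_s x; rewrite sx eqxx negbK.
  by exists nu; split=> //; right.
case: neq_st; apply/eq_cycle_typeP=> k _; apply: eq_card => x; rewrite !inE.
have := fix_s x; have := fix_t x; rewrite !negb_and !negbK.
have [sx|sx] := boolP (s x == x); have [tx|tx] := boolP (t x == x) => // _ _.
  by move: sx tx; rewrite -!card_porbit_eq1 => /eqP-> /eqP->.
by rewrite (porbit_eq_cent1 cst).
Qed.

End CycleType.

Theorem theorem1p1 (n : nat) (n_ge3 : 3 <= n) :
  (forall nu : seq nat,
     is_intpart (n - 2) nu -> 1 \notin nu -> 2 \notin nu ->
     forall C D : {set 'S_n},
       C \in classes [set: 'S_n] -> has_cycle_type C (adjoin_1_1 nu) ->
       D \in classes [set: 'S_n] -> has_cycle_type D (adjoin_2 nu) ->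
       same_z_class [set: 'S_n] C D)
  /\
  (forall C D : {set 'S_n},
     C \in classes [set: 'S_n] -> D \in classes [set: 'S_n] -> C != D ->
     same_z_class [set: 'S_n] C D ->
     exists nu : seq nat,
       [/\ is_intpart (n - 2) nu, 1 \notin nu, 2 \notin nu &
           (has_cycle_type C (adjoin_1_1 nu) /\ has_cycle_type D (adjoin_2 nu))
           \/
           (has_cycle_type C (adjoin_2 nu) /\ has_cycle_type D (adjoin_1_1 nu))]).
Proof.
have typeP (s : 'S_n) la :
    has_cycle_type (s ^: [set: 'S_n])%g la <-> cycle_type s = la.
  split=> [|<- _ /imsetP[g _ ->]]; last exact: cycle_typeJ.
  by apply; apply: class_refl.
split=> [nu _ nu1 nu2 C D | C D].
  move=> /imsetP[s _ ->] /typeP s_type /imsetP[d _ ->] /typeP d_type.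
  have [t [cst t_type]] := cent1_eq_adjoin_2 nu1 nu2 s_type.
  have [g dE] : exists g, d = (t ^ g)%g.
    by apply: conj_of_cycle_type; rewrite t_type.
  apply/same_z_classP; rewrite ?inE //; apply/z_conjugateP; exists g => //.
  by rewrite !setTI dE cent1J cst.
move=> /imsetP[s _ ->] /imsetP[d _ ->] neq_sd.
move/same_z_classP; rewrite !inE => /(_ isT isT)/z_conjugateP[g _].
rewrite !setTI -cent1J => csd.
have [|nu [nu_part nu1 nu2 types]] := cycle_types_cent1_eq (esym csd).
  rewrite cycle_typeJ => /conj_of_cycle_type[h dE]; case/eqP: neq_sd.
  by apply/esym/class_eqP; rewrite dE memJ_class ?inE.
exists nu; split=> //.
by case: types => -[]; rewrite cycle_typeJ; [left|right]; split; apply/typeP.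
Qed.
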